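(* Let $M_1,M_2,N_1,N_2\models T_{\mathrm{base}}$ and $k\in\mathbb{N}$. If $M_1\approx_k N_1$ and $M_2\approx_k N_2$, then $M_1\oplus M_2\approx_k N_1\oplus N_2$.
   Context: Let $\mathcal{L}=\{\subseteq,\bot,\mathrm{At},\lhd\}$ be the first-order language with binary relation symbols $\subseteq,\lhd$, a constant $\bot$ and a unary relation symbol $\mathrm{At}$. Lowercase variables range over atoms (elements satisfying $\mathrm{At}$); $X(x)$ abbreviates $x\subseteq X$. $T_{\mathrm{base}}$ is the $\mathcal{L}$-theory stating: $\subseteq$ is the order of an atomic Boolean algebra (one-element algebra allowed); $\lhd$ linearly orders the atoms; $\bot$ is least; $\mathrm{At}$ holds exactly of atoms; $\forall X\forall Y(X\lhd Y\leftrightarrow\exists x\exists y(X(x)\wedge Y(y)\wedge x\lhd y))$; and for every $\mathcal{L}$-formula $\eta(x;\bar Y)$, $\forall\bar Y\exists X\forall x(X(x)\leftrightarrow\eta(x;\bar Y))$. For $M,N\models T_{\mathrm{base}}$, $M\oplus N$ is the $\mathcal{L}$-structure with universe $|M|\times|N|$, $\subseteq$ componentwise, $\bot$ and $\mathrm{At}$ the bottom and atoms of the resulting product Boolean algebra, and $(A,B)\lhd(C,D)$ iff ($A\neq\bot$ in $M$ and $D\neq\bot$ in $N$) or $M\models A\lhd C$ or $N\models B\lhd D$. For $\mathcal{L}$-structures $M,N$, $M\approx_k N$ means $M$ and $N$ satisfy the same unnested $\mathcal{L}$-sentences of quantifier rank at most $k$ (unnested: every atomic subformula has the form $x=y$,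 $x=\bot$, $\mathrm{At}(x)$, $x\subseteq y$ or $x\lhd y$ with $x,y$ variables); equivalently, player II has a winning strategy in the $k$-round Ehrenfeucht–Fraïssé game on $M,N$, where in each round player I picks an element of either structure and II answers in the other, and II wins if the resulting $k$-tuples satisfy the same unnested atomic formulas. *)

(* Defs.v *)
From mathcomp Require Import all_boot.

Set Implicit Arguments.
Unset Strict Implicit.
Unset Printing Implicit Defensive.

Record Lstructure := LStructure {
  carrier :> Type;
  sub : carrier -> carrier -> Prop;
  bot : carrier;
  At : carrier -> Prop;
  lhd : carrier -> carrier -> Prop }.

Arguments bot M : rename.

(* Formulas are well scoped: [form n] has its free variables among the de
   Bruijn indices 'I_n, and a quantifier binds the index 0. *)
Inductive term (n : nat) :=
  | Var of 'I_n
  | Bot.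

Arguments Bot {n}.

Inductive form (n : nat) :=
  | FEq of term n & term n
  | FSub of term n & term n
  | FAt of term n
  | FLhd of term n & term n
  | FFalse
  | FNot of form n
  | FAnd of form n & form n
  | FOr of form n & form n
  | FImp of form n & form n
  | FAll of form n.+1
  | FEx of form n.+1.

Arguments FFalse {n}.

Definition scons (T : Type) (n : nat) (x : T) (v : 'I_n -> T) : 'I_n.+1 -> T :=
  fun i => oapp v x (unlift ord0 i).

Definition teval (M : Lstructure) (n : nat) (v : 'I_n -> M) (t : term n) : M :=
  match t with Var i => v i | Bot => bot M end.

Fixpoint sat (M : Lstructure) (n : nat) (v : 'I_n -> M) (f : form n) : Prop :=
  match f with
  | FEq s t => teval v s = teval v t
  | FSub s t => sub (teval v s) (teval v t)
  | FAt t => At (teval v t)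
  | FLhd s t => lhd (teval v s) (teval v t)
  | FFalse => False
  | FNot g => ~ sat v g
  | FAnd g h => sat v g /\ sat v h
  | FOr g h => sat v g \/ sat v h
  | FImp g h => sat v g -> sat v h
  | FAll g => forall x : M, sat (scons x v) g
  | FEx g => exists x : M, sat (scons x v) g
  end.

(* A sentence has no free variable, so the values of the assignment (a function
   on the empty type 'I_0) are never used. *)
Definition models (M : Lstructure) (f : form 0) : Prop :=
  sat (fun _ : 'I_0 => bot M) f.

Fixpoint qrank (n : nat) (f : form n) : nat :=
  match f with
  | FEq _ _ | FSub _ _ | FAt _ | FLhd _ _ | FFalse => 0
  | FNot g => qrank g
  | FAnd g h | FOr g h | FImp g h => maxn (qrank g) (qrank h)
  | FAll g | FEx g => (qrank g).+1
  end.

Fixpoint unnested (n : nat) (f : form n) : bool :=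
  match f with
  | FEq (Var _) (Var _) | FEq (Var _) Bot => true
  | FSub (Var _) (Var _) | FAt (Var _) | FLhd (Var _) (Var _) => true
  | FEq _ _ | FSub _ _ | FAt _ | FLhd _ _ => false
  | FFalse => true
  | FNot g => unnested g
  | FAnd g h | FOr g h | FImp g h => unnested g && unnested h
  | FAll g | FEx g => unnested g
  end.

Definition equiv_rank (k : nat) (M N : Lstructure) : Prop :=
  forall f : form 0, unnested f -> qrank f <= k -> (models M f <-> models N f).

Definition is_least (T : Type) (le : T -> T -> Prop) (b : T) : Prop :=
  forall x, le b x.

Definition is_greatest (T : Type) (le : T -> T -> Prop) (t : T) : Prop :=
  forall x, le x t.

Definition is_meet (T : Type) (le : T -> T -> Prop) (x y m : T) : Prop :=
  forall z, le z m <-> le z x /\ le z y.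

Definition is_join (T : Type) (le : T -> T -> Prop) (x y j : T) : Prop :=
  forall z, le j z <-> le x z /\ le y z.

Definition is_atom (T : Type) (le : T -> T -> Prop) (b a : T) : Prop :=
  a <> b /\ forall x, le x a -> x = b \/ x = a.

Record atomic_boolean_order (T : Type) (le : T -> T -> Prop) (b : T) : Prop := {
  abo_refl : forall x, le x x;
  abo_anti : forall x y, le x y -> le y x -> x = y;
  abo_trans : forall x y z, le x y -> le y z -> le x z;
  abo_least : is_least le b;
  abo_meet : forall x y, exists m, is_meet le x y m;
  abo_join : forall x y, exists j, is_join le x y j;
  abo_distr : forall x y z yz xy xz m,
    is_join le y z yz -> is_meet le x y xy -> is_meet le x z xz ->
    is_meet le x yz m -> is_join le xy xz m;
  abo_compl : exists t, is_greatest le t /\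
    forall x, exists y, is_meet le x y b /\ is_join le x y t;
  abo_atomic : forall x, x <> b -> exists a, is_atom le b a /\ le a x }.

Record Tbase (M : Lstructure) : Prop := {
  Tbase_boolean : atomic_boolean_order (@sub M) (bot M);
  Tbase_At : forall x : M, At x <-> is_atom (@sub M) (bot M) x;
  (* lhd restricts to a strict linear order on the atoms *)
  Tbase_lhd_irr : forall x : M, At x -> ~ lhd x x;
  Tbase_lhd_trans : forall x y z : M, At x -> At y -> At z ->
    lhd x y -> lhd y z -> lhd x z;
  Tbase_lhd_total : forall x y : M, At x -> At y ->
    lhd x y \/ x = y \/ lhd y x;
  Tbase_lhd : forall X Y : M, lhd X Y <->
    exists x y : M, [/\ At x, At y, sub x X, sub y Y & lhd x y];
  (* in eta, the index 0 is the atom variable and the others are parameters *)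
  Tbase_comprehension : forall (n : nat) (eta : form n.+1) (Y : 'I_n -> M),
    exists X : M, forall x : M, At x -> (sub x X <-> sat (scons x Y) eta) }.

Definition sum_sub (M N : Lstructure) (X Y : M * N) : Prop :=
  sub X.1 Y.1 /\ sub X.2 Y.2.

Definition sum_lhd (M N : Lstructure) (X Y : M * N) : Prop :=
  [\/ X.1 <> bot M /\ Y.2 <> bot N, lhd X.1 Y.1 | lhd X.2 Y.2].

Definition osum (M N : Lstructure) : Lstructure :=
  {| carrier := (M * N)%type;
     sub := @sum_sub M N;
     bot := (bot M, bot N);
     At := is_atom (@sum_sub M N) (bot M, bot N);
     lhd := @sum_lhd M N |}.

(* Main.v *)
Require Import Defs.
From mathcomp Require Import all_boot.
From Stdlib Require Import Classical.

Set Implicit Arguments.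
Unset Strict Implicit.
Unset Printing Implicit Defensive.

(** Up to logical equivalence there are finitely many unnested formulas of given
rank and free variables, so agreement on sentences of rank at most [k] yields a
winning strategy for player II in the [k]-round game (and conversely).  On a sum,
player II answers componentwise.  This wins because the unnested atomic formulas
of [M ⊕ N] are Boolean combinations of unnested atomic formulas of the
components; for [At] and [lhd] these include the formulas [x = ⊥]. *)

Definition atomic_equiv (M N : Lstructure) (n : nat) (v : 'I_n -> M) (w : 'I_n -> N) :=
  [/\ forall i j, v i = v j <-> w i = w j,
      forall i, v i = bot M <-> w i = bot N,
      forall i j, sub (v i) (v j) <-> sub (w i) (w j),
      forall i, At (v i) <-> At (w i)
    & forall i j, lhd (v i) (v j) <-> lhd (w i) (w j)].

(** Positions from which player II wins with [k] rounds left. Atomic agreement is demanded at every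
    stage, so it can be read off without playing the remaining rounds. *)
Fixpoint game_equiv (k : nat) (M N : Lstructure) (n : nat)
    (v : 'I_n -> M) (w : 'I_n -> N) : Prop :=
  atomic_equiv v w /\
  if k is k'.+1 then
    (forall x, exists y, game_equiv k' (scons x v) (scons y w)) /\
    (forall y, exists x, game_equiv k' (scons x v) (scons y w))
  else True.

Lemma game_equiv_atomic k (M N : Lstructure) n (v : 'I_n -> M) (w : 'I_n -> N) :
  game_equiv k v w -> atomic_equiv v w.
Proof. by case: k => [|k] []. Qed.

(** Induction on [f] with [k] and the position general: a quantifier costs one round, a connective
    none. *)
Lemma game_equiv_sat k (M N : Lstructure) n (f : form n) (v : 'I_n -> M) (w : 'I_n -> N) :
  game_equiv k v w -> unnested f -> qrank f <= k -> (sat v f <-> sat w f).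
Proof.
elim: f k v w => {n} [n s t|n s t|n t|n s t|n|n g IHg|n g IHg h IHh|n g IHg h IHh
  |n g IHg h IHh|n g IHg|n g IHg] k v w vw /=.
- by have [e b _ _ _] := game_equiv_atomic vw; case: s => [i|]; case: t => [j|] //= _ _.
- by have [_ _ e _ _] := game_equiv_atomic vw; case: s => [i|]; case: t => [j|] //= _ _.
- by have [_ _ _ e _] := game_equiv_atomic vw; case: t => [i|] //= _ _.
- by have [_ _ _ _ e] := game_equiv_atomic vw; case: s => [i|]; case: t => [j|] //= _ _.
- by [].
- by move=> ug kg; have := IHg k v w vw ug kg; tauto.
- rewrite geq_max => /andP[ug uh] /andP[kg kh].
  by have := IHg k v w vw ug kg; have := IHh k v w vw uh kh; tauto.
- rewrite geq_max => /andP[ug uh] /andP[kg kh].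
  by have := IHg k v w vw ug kg; have := IHh k v w vw uh kh; tauto.
- rewrite geq_max => /andP[ug uh] /andP[kg kh].
  by have := IHg k v w vw ug kg; have := IHh k v w vw uh kh; tauto.
- case: k vw => // k [_ [forth back]] ug kg; split=> H.
  + by move=> y; have [x xy] := back y; apply/(IHg k _ _ xy ug kg).
  + by move=> x; have [y xy] := forth x; apply/(IHg k _ _ xy ug kg).
- case: k vw => // k [_ [forth back]] ug kg; split=> -[].
  + by move=> x; have [y xy] := forth x; exists y; apply/(IHg k _ _ xy ug kg).
  + by move=> y; have [x xy] := back y; exists x; apply/(IHg k _ _ xy ug kg).
Qed.

(** A complete description relative to [F]: the pattern [s] prescribes the truth value of every
    [F i]. [FNot FFalse] serves as the empty conjunction. *)
Definition sign_conj (n : nat) (I : finType) (F : I -> form n) (s : {ffun I -> bool}) :=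
  \big[@FAnd n/FNot FFalse]_i (if s i then F i else FNot (F i)).

Lemma sat_big_FAnd (M : Lstructure) n (v : 'I_n -> M) (I : finType) (G : I -> form n) :
  sat v (\big[@FAnd n/FNot FFalse]_i G i) <-> forall i, sat v (G i).
Proof.
(* [FAnd] is not associative as syntax, so the conjunction is unfolded along its list of indices. *)
suff H r : sat v (\big[@FAnd n/FNot FFalse]_(i <- r) G i) <->
    forall i, i \in r -> sat v (G i).
  rewrite H; split=> Hs i; last by [].
  by apply: Hs; rewrite mem_index_enum.
elim: r => [|i r IH]; first by rewrite big_nil; split=> // _ [].
rewrite big_cons /= IH; split=> [[Gi Gr] j|Gr].
  by rewrite inE => /predU1P[->|/Gr].
by split=> [|j jr]; apply: Gr; rewrite inE ?eqxx ?jr ?orbT.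
Qed.

Lemma sat_sign_conj (M : Lstructure) n (v : 'I_n -> M)
    (I : finType) (F : I -> form n) s :
  sat v (sign_conj F s) <-> forall i, s i <-> sat v (F i).
Proof.
rewrite sat_big_FAnd; split=> H i; move: (H i); case: (s i) => //=.
- by move=> [Fi _]; apply: Fi.
- by move=> [_ nF] /nF.
Qed.

Lemma unnested_sign_conj n (I : finType) (F : I -> form n) s :
  (forall i, unnested (F i)) -> unnested (sign_conj F s).
Proof.
move=> uF; apply: (big_ind (@unnested n)) => //= [f g -> -> //|i _].
by case: (s i); apply: uF.
Qed.

Lemma qrank_sign_conj n (I : finType) (F : I -> form n) s k :
  (forall i, qrank (F i) <= k) -> qrank (sign_conj F s) <= k.
Proof.
move=> kF; apply: (big_ind (fun f => qrank f <= k)) => //= [f g kf kg|i _].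
  by rewrite geq_max kf.
by case: (s i); apply: kF.
Qed.

Lemma exists_sign_conj (M : Lstructure) n (v : 'I_n -> M) (I : finType) (F : I -> form n) :
  exists s, sat v (sign_conj F s).
Proof.
(* Excluded middle gives a truth value for each index; finiteness of [I] collects them into one
   function. *)
have /fin_all_exists[s sP] (i : I) : exists b : bool, b <-> sat v (F i).
  by have [Fi|nFi] := classic (sat v (F i)); [exists true | exists false].
by exists [ffun i => s i]; apply/sat_sign_conj => i; rewrite ffunE.
Qed.

(** The pattern realised by [x] is realised in [N] as well, and any witness of it there is a correct
    answer to [x]. *)
Lemma forth_sign_conj (M N : Lstructure) n (v : 'I_n -> M) (w : 'I_n -> N)
    (I : finType) (F : I -> form n.+1) :
  (forall s, sat v (FEx (sign_conj F s)) -> sat w (FEx (sign_conj F s))) ->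
  forall x, exists y, forall i, sat (scons x v) (F i) <-> sat (scons y w) (F i).
Proof.
move=> H x; have [s sx] := exists_sign_conj (scons x v) F.
have [|y sy] := H s; first by exists x.
exists y => i; move/sat_sign_conj: sx => /(_ i) <-.
by move/sat_sign_conj: sy => /(_ i).
Qed.

(** All five shapes share one finite index type, so a one-variable shape is repeated for each [j].
    The default [FFalse] is never reached, as [c < 5]. *)
Definition unnested_atomic (n : nat) (a : 'I_5 * 'I_n * 'I_n) : form n :=
  let: (c, i, j) := a in
  nth FFalse [:: FEq (Var i) (Var j); FEq (Var i) Bot; FSub (Var i) (Var j);
                 FAt (Var i); FLhd (Var i) (Var j)] c.

Lemma atomic_equivP (M N : Lstructure) n (v : 'I_n -> M) (w : 'I_n -> N) :
  (forall a, sat v (unnested_atomic a) <-> sat w (unnested_atomic a)) ->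
  atomic_equiv v w.
Proof.
move=> H; split=> [i j|i|i j|i|i j].
- exact: (H (Ordinal (isT : 0 < 5), i, j)).
- exact: (H (Ordinal (isT : 1 < 5), i, i)).
- exact: (H (Ordinal (isT : 2 < 5), i, j)).
- exact: (H (Ordinal (isT : 3 < 5), i, i)).
- exact: (H (Ordinal (isT : 4 < 5), i, j)).
Qed.

Lemma unnested_unnested_atomic n (a : 'I_5 * 'I_n * 'I_n) :
  unnested (unnested_atomic a).
Proof. by case: a => -[[[|[|[|[|[|c]]]]] lt_c] i] j. Qed.

Lemma qrank_unnested_atomic n (a : 'I_5 * 'I_n * 'I_n) :
  qrank (unnested_atomic a) = 0.
Proof. by case: a => -[[[|[|[|[|[|c]]]]] lt_c] i] j. Qed.

(** The basis is chosen before the structures. For rank [k.+1] it consists of the atomic formulas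
    and, for each pattern over the rank [k] basis in one more variable, the statement that some
    element realises it; there are finitely many patterns. *)
Lemma finite_game_basis k n : exists (I : finType) (F : I -> form n),
  [/\ forall i, unnested (F i), forall i, qrank (F i) <= k
    & forall (M N : Lstructure) (v : 'I_n -> M) (w : 'I_n -> N),
      (forall i, sat v (F i) <-> sat w (F i)) -> game_equiv k v w].
Proof.
elim: k n => [|k IHk] n.
  exists ('I_5 * 'I_n * 'I_n)%type, (@unnested_atomic n); split=> [a|a|M N v w H].
  - exact: unnested_unnested_atomic.
  - by rewrite qrank_unnested_atomic.
  - by split=> //; apply: atomic_equivP.
have [I [F [uF kF gF]]] := IHk n.+1.
exists ('I_5 * 'I_n * 'I_n + {ffun I -> bool})%type.
exists (fun a => match a with
  | inl a => unnested_atomic a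
  | inr s => FEx (sign_conj F s)
  end); split=> [[a|s]|[a|s]|M N v w H] /=.
- exact: unnested_unnested_atomic.
- exact: unnested_sign_conj.
- by rewrite qrank_unnested_atomic.
- exact: qrank_sign_conj.
- split; first by apply: atomic_equivP => a; apply: (H (inl a)).
  split=> [x|y].
  + have [s|y xy] := @forth_sign_conj _ _ _ v w _ F _ x.
      exact: (H (inr s)).1.
    by exists y; apply: gF.
  (* The back condition is the forth condition with the two structures exchanged. *)
  + have [s|x xy] := @forth_sign_conj _ _ _ w v _ F _ y.
      exact: (H (inr s)).2.
    by exists x; apply: gF => i; split=> /xy.
Qed.

Lemma equiv_rank_game k M N : equiv_rank k M N ->
  game_equiv k (fun _ : 'I_0 => bot M) (fun _ : 'I_0 => bot N).
Proof.
have [I [F [uF kF gF]]] := finite_game_basis k 0.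
by move=> MN; apply: gF => i; apply: MN.
Qed.

(** Below [(A, B)] lie [(A, bot N)] and [(bot M, B)], so an atom has a bottom coordinate, and its
    minimality passes to the other coordinate. *)
Lemma osum_atomP M N : Tbase M -> Tbase N -> forall X : osum M N,
  At X <-> (At X.1 /\ X.2 = bot N) \/ (X.1 = bot M /\ At X.2).
Proof.
move=> hM hN [A B]; rewrite /= (Tbase_At hM) (Tbase_At hN).
have lM := abo_least (Tbase_boolean hM); have lN := abo_least (Tbase_boolean hN).
have rM := abo_refl (Tbase_boolean hM); have rN := abo_refl (Tbase_boolean hN).
have aM := abo_anti (Tbase_boolean hM); have aN := abo_anti (Tbase_boolean hN).
split=> [[AB0 ABmin]|[[[A0 Amin] ->]|[-> [B0 Bmin]]]].
- have [A0|A0] := classic (A = bot M).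
  + right; split=> //; split=> [B0|x xB]; first by apply: AB0; rewrite A0 B0.
    by have [|[_ ->]|[->]] := ABmin (A, x); [split|left|right].
  (* As [A] is not bottom, [(A, bot N)] must be the atom itself, whence [B] is bottom. *)
  + have [|[//]|[B0]] := ABmin (A, bot N); first by split=> /=.
    left; split=> //; split=> // x xA.
    by have [|[-> _]|[->]] := ABmin (x, B); [split|left|right].
- split=> [[/A0//]|[x y] [/= /Amin xA yB]].
  by rewrite (aN y (bot N)) //; case: xA => ->; [left|right].
- split=> [[/B0//]|[x y] [/= xA /Bmin yB]].
  by rewrite (aM x (bot M)) //; case: yB => ->; [left|right].
Qed.

(** Assignments into a sum are tied to their components by pointwise equations, which survive
    [scons] without functional extensionality. *)
Lemma osum_atomic_equiv (M1 M2 N1 N2 : Lstructure) n 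
    (v1 : 'I_n -> M1) (v2 : 'I_n -> M2)
    (w1 : 'I_n -> N1) (w2 : 'I_n -> N2)
    (v : 'I_n -> osum M1 M2) (w : 'I_n -> osum N1 N2) :
  Tbase M1 -> Tbase M2 -> Tbase N1 -> Tbase N2 ->
  (forall i, v i = (v1 i, v2 i)) -> (forall i, w i = (w1 i, w2 i)) ->
  atomic_equiv v1 w1 -> atomic_equiv v2 w2 -> atomic_equiv v w.
Proof.
move=> hM1 hM2 hN1 hN2 vE wE [e1 b1 s1 a1 l1] [e2 b2 s2 a2 l2].
have pairE (A B : Type) (a c : A) (b d : B) : (a, b) = (c, d) <-> a = c /\ b = d.
  by split=> [[-> ->]|[-> ->]].
split=> [i j|i|i j|i|i j].
- by rewrite !vE !wE !pairE e1 e2.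
- by rewrite vE wE !pairE b1 b2.
- by rewrite !vE !wE /= /sum_sub /= s1 s2.
- by rewrite (osum_atomP hM1 hM2) (osum_atomP hN1 hN2) vE wE /= a1 a2 b1 b2.
- rewrite !vE !wE /= /sum_lhd /=.
  have := b1 i; have := b2 j; have := l1 i j; have := l2 i j.
  by move=> L2 L1 B2 B1; split=> -[[]|/L1|/L2]; by [constructor 1; tauto|constructor 2|constructor 3].
Qed.

Lemma scons_pair (A B : Type) n (x : A * B) (v : 'I_n -> A * B) v1 v2 :
  (forall i, v i = (v1 i, v2 i)) ->
  forall i, scons x v i = (scons x.1 v1 i, scons x.2 v2 i).
Proof. by move=> vE i; rewrite /scons; case: unlift => //=; case: x. Qed.

Lemma osum_game_equiv k (M1 M2 N1 N2 : Lstructure) n 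
    (v1 : 'I_n -> M1) (v2 : 'I_n -> M2)
    (w1 : 'I_n -> N1) (w2 : 'I_n -> N2)
    (v : 'I_n -> osum M1 M2) (w : 'I_n -> osum N1 N2) :
  Tbase M1 -> Tbase M2 -> Tbase N1 -> Tbase N2 ->
  (forall i, v i = (v1 i, v2 i)) -> (forall i, w i = (w1 i, w2 i)) ->
  game_equiv k v1 w1 -> game_equiv k v2 w2 -> game_equiv k v w.
Proof.
move=> hM1 hM2 hN1 hN2.
elim: k n v1 v2 w1 w2 v w => [|k IHk] n v1 v2 w1 w2 v w vE wE.
  by move=> [a1 _] [a2 _]; split=> //; apply: osum_atomic_equiv vE wE a1 a2.
move=> [a1 [f1 g1]] [a2 [f2 g2]].
split; first exact: osum_atomic_equiv vE wE a1 a2.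
split=> [x|y].
- have [y1 xy1] := f1 x.1; have [y2 xy2] := f2 x.2.
  by exists (y1, y2); apply: IHk xy1 xy2; apply: scons_pair.
- have [x1 xy1] := g1 y.1; have [x2 xy2] := g2 y.2.
  by exists (x1, x2); apply: IHk xy1 xy2; apply: scons_pair.
Qed.

Theorem theorem2p23 (M1 M2 N1 N2 : Lstructure) (k : nat)
    (hM1 : Tbase M1) (hM2 : Tbase M2) (hN1 : Tbase N1) (hN2 : Tbase N2)
    (h1 : equiv_rank k M1 N1) (h2 : equiv_rank k M2 N2) :
  equiv_rank k (osum M1 M2) (osum N1 N2).
Proof.
move=> f uf kf; apply: (@game_equiv_sat k) => //.
(* The pointwise equations hold by computation, since the bottom of a sum is the pair of bottoms. *)
by apply: osum_game_equiv (equiv_rank_game h1) (equiv_rank_game h2).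
Qed.
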